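(* Let $G$ be a finitely generated residually-(torsion-free nilpotent) group and let $H\leq G$ be a virtually polycyclic subgroup. Then $H$ is nilpotent and, for all primes $p$, the pro-$p$ topology of $G$ induces on $H$ its full pro-$p$ topology.
   Context: $G$ is residually-(torsion-free nilpotent) if for every $1\neq g\in G$ there is a normal subgroup $N$ of $G$ with $g\notin N$ and $G/N$ torsion-free nilpotent. The (full) pro-$p$ topology of a group $G$ is the topology generated by the cosets of the normal subgroups $U$ of $G$ such that $G/U$ is a finite $p$-group. Saying that the pro-$p$ topology of $G$ induces on $H$ its full pro-$p$ topology means that the subspace topology on $H$ inherited from the pro-$p$ topology of $G$ equals the pro-$p$ topology of $H$; equivalently, the induced map of pro-$p$ completions $H_{\hat p}\to G_{\hat p}$ is injective. *)

(* Defs.v *)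
From HB Require Import structures.
From mathcomp Require Import all_boot generic_quotient.
From mathcomp Require Import boolp classical_sets functions cardinality.
From mathcomp Require Import topology_structure initial_topology.

Set Implicit Arguments.
Unset Strict Implicit.
Unset Printing Implicit Defensive.

Local Open Scope classical_set_scope.
Local Open Scope quotient_scope.
Local Open Scope card_scope.
Local Open Scope group_scope.

(* A subgroup of a possibly infinite group G is a term of the library type
   [groupClosed G], that is, a bool-valued predicate on G closed under the
   group operations; classically ([boolp.asbool]) these are all subgroups. *)

HB.mixin Record isConjClosed (G : groupType) (S : {pred G}) := {
  gpredJ : forall x y : G, x \in S -> x ^ y \in S
}.

#[short(type="normalClosed")]
HB.structure Definition NormalClosed (G : groupType) :=
  {S of isConjClosed G S & GroupClosed G S}.

Record subgrp (G : groupType) (H : groupClosed G) := Subgrp {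
  subgrp_val : G;
  subgrp_valP : subgrp_val \in H
}.

Section SubgrpGroup.
Variables (G : groupType) (H : groupClosed G).

HB.instance Definition _ := [isSub for @subgrp_val G H].
HB.instance Definition _ := [Choice of subgrp H by <:].

Fact subgrp_closed : group_closed [in H].
Proof.
split=> [|x y]; first exact: gpred1.
by move=> Hx Hy; apply: gpredM; rewrite ?gpredV.
Qed.

HB.instance Definition _ :=
  SubChoice_isSubGroup.Build G [in H] (subgrp H) subgrp_closed.

End SubgrpGroup.

(* The quotient group G / N: x and y are identified when x N = y N. *)
Section QuotgrpGroup.
Variables (G : groupType) (N : normalClosed G).

Definition coset_eq (x y : G) : bool := x^-1 * y \in N.

Fact coset_eq_refl : reflexive coset_eq.
Proof. by move=> x; rewrite /coset_eq mulVg gpred1. Qed.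

Fact coset_eq_sym : symmetric coset_eq.
Proof. by move=> x y; rewrite /coset_eq -gpredV invgM invgK. Qed.

Fact coset_eq_trans : transitive coset_eq.
Proof.
move=> y x z; rewrite /coset_eq => Nxy Nyz.
by have := gpredM _ _ Nxy Nyz; rewrite -mulgA mulVKg.
Qed.

Definition coset_equiv : equiv_rel G :=
  EquivRel coset_eq coset_eq_refl coset_eq_sym coset_eq_trans.

Definition quotgrp : Type := {eq_quot coset_equiv}.

HB.instance Definition _ := Choice.on quotgrp.
HB.instance Definition _ := EqQuotient.on quotgrp.

Definition quotgrp_one : quotgrp := \pi_quotgrp 1.
Definition quotgrp_inv (u : quotgrp) : quotgrp := \pi_quotgrp (repr u)^-1.
Definition quotgrp_mul (u v : quotgrp) : quotgrp :=
  \pi_quotgrp (repr u * repr v).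

Fact quotgrp_eqP (x y : G) :
  reflect (\pi_quotgrp x = \pi_quotgrp y) (x^-1 * y \in N).
Proof. by apply: (iffP idP) => [h|/eqmodP]; first apply/eqmodP. Qed.

Fact quotgrp_reprP (x : G) : (repr (\pi_quotgrp x))^-1 * x \in N.
Proof. by apply/quotgrp_eqP; rewrite reprK. Qed.

Fact quotgrp_mulE (x y : G) :
  quotgrp_mul (\pi_quotgrp x) (\pi_quotgrp y) = \pi_quotgrp (x * y).
Proof.
apply/quotgrp_eqP.
set a := repr _; set b := repr _.
have Na : a^-1 * x \in N by exact: quotgrp_reprP.
have Nb : b^-1 * y \in N by exact: quotgrp_reprP.
have -> : (a * b)^-1 * (x * y) = (b^-1 * y) * (a^-1 * x) ^ y.
  by rewrite /conjg invgM !mulgA mulgK.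
by apply: gpredM => //; apply: gpredJ.
Qed.

Fact quotgrp_invE (x : G) : quotgrp_inv (\pi_quotgrp x) = \pi_quotgrp x^-1.
Proof.
apply/quotgrp_eqP; set a := repr _.
have Na : a^-1 * x \in N by exact: quotgrp_reprP.
have -> : a^-1^-1 * x^-1 = ((a^-1 * x)^-1) ^ a^-1.
  by rewrite /conjg invgM !invgK mulgK.
by apply: gpredJ; rewrite gpredV.
Qed.

Fact quotgrp_mulA : associative quotgrp_mul.
Proof.
elim/quotW=> x; elim/quotW=> y; elim/quotW=> z.
by rewrite (quotgrp_mulE y z) (quotgrp_mulE x y) !quotgrp_mulE mulgA.
Qed.

Fact quotgrp_mul1 : left_id quotgrp_one quotgrp_mul.
Proof. by elim/quotW=> x; rewrite quotgrp_mulE mul1g. Qed.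

Fact quotgrp_mulr1 : right_id quotgrp_one quotgrp_mul.
Proof. by elim/quotW=> x; rewrite quotgrp_mulE mulg1. Qed.

Fact quotgrp_mulV : left_inverse quotgrp_one quotgrp_inv quotgrp_mul.
Proof.
by elim/quotW=> x; rewrite quotgrp_invE quotgrp_mulE mulVg.
Qed.

Fact quotgrp_mulrV : right_inverse quotgrp_one quotgrp_inv quotgrp_mul.
Proof.
by elim/quotW=> x; rewrite quotgrp_invE quotgrp_mulE mulgV.
Qed.

HB.instance Definition _ := isGroup.Build quotgrp
  quotgrp_mulA quotgrp_mul1 quotgrp_mulr1 quotgrp_mulV quotgrp_mulrV.

End QuotgrpGroup.

Definition generated (G : groupType) (A : set G) : set G :=
  [set x | forall K : groupClosed G, A `<=` [set` K] -> x \in K].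

Definition finitely_generated (G : groupType) : Prop :=
  exists s : seq G, generated [set` s] = setT.

Definition cyclic_group (G : groupType) : Prop :=
  exists g : G, generated [set g] = setT.

Definition torsion_free (G : groupType) : Prop :=
  forall (x : G) (n : nat), (0 < n)%N -> x ^+ n = 1 -> x = 1.

(* Indexed from 0, so that [lower_central G 0] is G itself. *)
Fixpoint lower_central (G : groupType) (n : nat) : set G :=
  if n is m.+1 then
    generated [set [~ x, y] | x in lower_central m & y in [set: G]]
  else setT.
Arguments lower_central G n : clear implicits.

Definition nilpotent_group (G : groupType) : Prop :=
  exists n : nat, lower_central G n = [set 1].

Definition residually_torsion_free_nilpotent (G : groupType) : Prop :=
  forall g : G, g <> 1 -> exists N : normalClosed G,
    [/\ g \notin N, torsion_free (quotgrp N) & nilpotent_group (quotgrp N)].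

(* A finite series 1 = K_0 <= K_1 <= ... <= K_n = G, each term normal in the
   next one, with cyclic factors; N is K_i viewed inside the group K_(i+1). *)
Definition polycyclic (G : groupType) : Prop :=
  exists (n : nat) (K : nat -> groupClosed G),
    [/\ [set` K 0%N] = [set 1],
        [set` K n] = setT
      & forall i : nat, (i < n)%N ->
          [set` K i] `<=` [set` K i.+1] /\
          exists N : normalClosed (subgrp (K i.+1)),
            (forall x : subgrp (K i.+1), (x \in N) = (\val x \in K i)) /\
            cyclic_group (quotgrp N)].

Definition finite_index (G : groupType) (K : groupClosed G) : Prop :=
  finite_set [set [set g * k | k in [set` K]] | g in [set: G]].

Definition virtually_polycyclic (G : groupType) : Prop :=
  exists K : groupClosed G, finite_index K /\ polycyclic (subgrp K).

Definition finite_pgroup (p : nat) (G : groupType) : Prop :=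
  exists k : nat, [set: G] #= `I_(p ^ k)%N.

Definition pro_p_cosets (p : nat) (G : groupType) : set (set G) :=
  [set A | exists (U : normalClosed G) (g : G),
     finite_pgroup p (quotgrp U) /\ A = [set g * u | u in [set` U]]].
Arguments pro_p_cosets p G : clear implicits.

(* An alias of G, so that its topology can depend on p. *)
Definition pro_p (p : nat) (G : groupType) : Type := G.

HB.instance Definition _ (p : nat) (G : groupType) := Choice.on (pro_p p G).
HB.instance Definition _ (p : nat) (G : groupType) :=
  isSubBaseTopological.Build (pro_p p G) (pro_p_cosets p G) id.

Definition induces_full_pro_p (p : nat) (G : groupType) (H : groupClosed G) :
    Prop :=
  @open (initial_topology (\val : subgrp H -> pro_p p G)) =
  @open (pro_p p (subgrp H)).

(* Main.v *)
(* Since [H] is virtually polycyclic, a normal subgroup [N] of [G] with [G / N]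
   torsion-free nilpotent and [H :&: N] of minimal Hirsch length meets [H]
   trivially: two such [N] intersect in a third, and a proper isolated subgroup
   has smaller Hirsch length.  So [H] embeds in [G / N] and is nilpotent.

   As [G / N] is a finitely generated nilpotent group, [H N] and [G] are joined
   by a finite chain in which each term is [A <x>], with [A] the previous term
   and [x] normalizing [A].  A subgroup of [A] containing [N] and the powers
   [a ^+ (p ^ e)], for [a] in [A], extends to a subgroup of [A <x>] of the same
   kind: with [U0] generated by [N] and these powers, nilpotency forces a power
   [x ^+ (p ^ k)] to centralize [A] modulo [U0], and one adjoins it to [U0].  At
   the top of the chain this gives a normal subgroup [V] of [G] with [G / V] of
   exponent a power of [p]; being finitely generated nilpotent, [G / V] is a
   finite [p]-group. *)
From HB Require Import structures.
From mathcomp Require Import all_boot finmap zify.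
From mathcomp Require Import fingroup cyclic pgroup generic_quotient.
From mathcomp Require Import boolp classical_sets functions cardinality filter.
From mathcomp Require Import topology_structure initial_topology.
Require Import Defs.

Set Implicit Arguments.
Unset Strict Implicit.
Unset Printing Implicit Defensive.

Local Open Scope quotient_scope.
Local Open Scope group_scope.
Local Open Scope classical_set_scope.
Local Open Scope card_scope.

(** * Subgroups and normal subgroups given as sets *)

Definition subgroup_set (G : groupType) (A : set G) : Prop :=
  A 1 /\ forall x y, A x -> A y -> A (x * y^-1).

Section SubgroupSet.
Variables (G : groupType) (A : set G).
Hypothesis sA : subgroup_set A.

Lemma sgrp1 : A 1. Proof. by case: sA. Qed.

Lemma sgrpV x : A x -> A x^-1.
Proof. by case: sA => A1 AD Ax; rewrite -[x^-1]mul1g; apply: AD. Qed.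

Lemma sgrpM x y : A x -> A y -> A (x * y).
Proof. by case: sA => _ AD Ax /sgrpV Ay; rewrite -[y]invgK; apply: AD. Qed.

Lemma sgrpX x n : A x -> A (x ^+ n).
Proof.
move=> Ax; elim: n => [|n IH]; first by rewrite expg0; exact: sgrp1.
by rewrite expgS; apply: sgrpM.
Qed.

Lemma sgrpJ x y : A x -> A y -> A (x ^ y).
Proof. by move=> Ax Ay; apply: sgrpM; [exact: sgrpV | exact: sgrpM]. Qed.

Lemma sgrpMl x y : A x -> A (x * y) -> A y.
Proof. by move=> Ax Axy; rewrite -(mulKg x y); apply: sgrpM => //; exact: sgrpV. Qed.

Lemma sgrpMr x y : A y -> A (x * y) -> A x.
Proof. by move=> Ay Axy; rewrite -(mulgK y x); apply: sgrpM => //; exact: sgrpV. Qed.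

(** The proof that [A] is a subgroup is an argument, so that the closure structures below can be
    attached to the predicate. *)
Definition pred_of_subgroup of subgroup_set A : {pred G} := fun x => `[< A x >].

Local Notation P := (pred_of_subgroup sA).

Fact pred_of_subgroup_M : {in P &, forall u v, u * v \in P}.
Proof. by move=> u v /asboolP Au /asboolP Av; apply/asboolP; apply: sgrpM. Qed.
Fact pred_of_subgroup_1 : 1 \in P.
Proof. by apply/asboolP; apply: sgrp1. Qed.
Fact pred_of_subgroup_V : {in P, forall u, u^-1 \in P}.
Proof. by move=> u /asboolP Au; apply/asboolP; apply: sgrpV. Qed.

End SubgroupSet.

HB.instance Definition _ (G : groupType) (A : set G) (sA : subgroup_set A) :=
  isMulClosed.Build G (pred_of_subgroup sA) (@pred_of_subgroup_M G A sA).
HB.instance Definition _ (G : groupType) (A : set G) (sA : subgroup_set A) :=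
  isMul1Closed.Build G (pred_of_subgroup sA) (@pred_of_subgroup_1 G A sA).
HB.instance Definition _ (G : groupType) (A : set G) (sA : subgroup_set A) :=
  isInvClosed.Build G (pred_of_subgroup sA) (@pred_of_subgroup_V G A sA).

Definition normal_set (G : groupType) (A : set G) : Prop :=
  subgroup_set A /\ forall x y, A x -> A (x ^ y).

Definition pred_of_normal (G : groupType) (A : set G) (nA : normal_set A) :
  {pred G} := pred_of_subgroup (proj1 nA).

HB.instance Definition _ (G : groupType) (A : set G) (nA : normal_set A) :=
  GroupClosed.on (pred_of_normal nA).

Fact pred_of_normal_J (G : groupType) (A : set G) (nA : normal_set A) x y :
  x \in pred_of_normal nA -> x ^ y \in pred_of_normal nA.
Proof. by move=> /asboolP Ax; apply/asboolP; apply: (proj2 nA). Qed.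

HB.instance Definition _ (G : groupType) (A : set G) (nA : normal_set A) :=
  isConjClosed.Build G (pred_of_normal nA) (@pred_of_normal_J G A nA).

Definition normalClosed_of (G : groupType) (A : set G) (nA : normal_set A) :
  normalClosed G := NormalClosed.clone G (pred_of_normal nA) _.

Lemma in_normalClosed_of (G : groupType) (A : set G) (nA : normal_set A) x :
  (x \in normalClosed_of nA) = `[< A x >].
Proof. by []. Qed.

Lemma subgroup_set_pred (G : groupType) (K : groupClosed G) :
  subgroup_set [set` K].
Proof. by split=> [|x y /= Kx Ky]; [exact: gpred1 | exact: gpredF]. Qed.

Lemma normal_set_pred (G : groupType) (N : normalClosed G) :
  normal_set [set` N].
Proof. by split=> [|x y /=]; [exact: subgroup_set_pred | exact: Defs.gpredJ]. Qed.

Section Generated.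
Variable G : groupType.
Implicit Types A B : set G.

Lemma generated_min A B : subgroup_set B -> A `<=` B -> generated A `<=` B.
Proof.
move=> sB AB x gx.
by have /asboolP : x \in pred_of_subgroup sB by apply: gx => y /AB /asboolP.
Qed.

Lemma sub_generated A : A `<=` generated A.
Proof. by move=> x Ax K AK; apply: AK. Qed.

Lemma generated_sgrp A : subgroup_set (generated A).
Proof.
split=> [K _|x y gx gy K AK]; first exact: gpred1.
by apply: gpredF; [apply: gx | apply: gy].
Qed.

Lemma preimage_sgrp (M : groupType) (f : UMagmaMorphism.type M G) A :
  subgroup_set A -> subgroup_set (f @^-1` A).
Proof.
move=> sA; split=> [|x y /= Ax Ay]; first by rewrite /= gmulf1; exact: sgrp1.
by rewrite gmulfF; apply: sgrpM => //; apply: sgrpV.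
Qed.

End Generated.

(** * Adjoining a normalizing element *)

Section Cycle.
Variables (G : groupType) (x : G).

(** Exponents are natural numbers, hence the two signs. A product of powers of opposite signs is
    settled by comparing exponents. *)
Lemma cycle_setP y :
  generated [set x] y <-> exists n, y = x ^+ n \/ y = x^-1 ^+ n.
Proof.
split; last first.
  have sx := generated_sgrp [set x].
  have gx : generated [set x] x by exact: sub_generated.
  by move=> [n [->|->]]; apply: (sgrpX sx) => //; apply: (sgrpV sx).
suff : generated [set x] `<=`
    [set z | exists n, z = x ^+ n \/ z = x^-1 ^+ n] by apply.
apply: generated_min => [|_ ->]; last by exists 1%N; left; rewrite expg1.
split=> [|y1 y2 [m Hm] [n Hn]]; first by exists 0%N; left; rewrite expg0.
have posE k l : exists j, x ^+ k * x^-1 ^+ l = x ^+ j \/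
                          x ^+ k * x^-1 ^+ l = x^-1 ^+ j.
  rewrite !expVgn; have [le_lk|/ltnW le_kl] := leqP l k.
    by exists (k - l)%N; left; rewrite expgnFr.
  by exists (l - k)%N; right; rewrite expVgn expgnFr // invgM invgK.
have posE' k l : exists j, x^-1 ^+ k * x ^+ l = x ^+ j \/
                           x^-1 ^+ k * x ^+ l = x^-1 ^+ j.
  have -> : x^-1 ^+ k * x ^+ l = x ^+ l * x^-1 ^+ k.
    by apply: commuteX2; apply: commute_sym; apply: commuteV; exact: commute_refl.
  exact: posE.
case: Hm => ->; case: Hn => -> {y1 y2}.
- by rewrite -expVgn; exact: posE.
- by rewrite expVgn invgK -expgnDr; exists (m + n)%N; left.
- by rewrite -expVgn -expgnDr; exists (m + n)%N; right.
- by rewrite (expVgn _ n) invgK; exact: posE'.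
Qed.

End Cycle.

(** Both signs are required: in an infinite group the conjugate of [A] by [x] may be a proper subset
    of [A]. *)
Definition normalizes (G : groupType) (A : set G) (x : G) : Prop :=
  forall a, A a -> A (a ^ x) /\ A (a ^ x^-1).

Section Normalizes.
Variables (G : groupType).
Implicit Types (A B : set G) (x : G).

Lemma normalizer_sgrp A : subgroup_set (normalizes A).
Proof.
split=> [a Aa|x y Nx Ny a Aa]; first by rewrite invg1 conjg1.
rewrite invgM invgK !conjgM; split.
  by case: (Nx a Aa) => /Ny[].
by case: (Ny a Aa) => /Nx[].
Qed.

Lemma normalizes_self A x : subgroup_set A -> A x -> normalizes A x.
Proof. by move=> sA Ax a Aa; split; apply: sgrpJ => //; apply: sgrpV. Qed.

Lemma normalizes_generated A x : normalizes A x -> normalizes (generated A) x.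
Proof.
move=> Nx.
have H y : (forall a, A a -> A (a ^ y)) -> forall a, generated A a ->
    generated A (a ^ y).
  move=> NAy; apply: generated_min => [|a Aa]; last first.
    by apply: sub_generated; apply: NAy.
  have sA := generated_sgrp A.
  split=> [|a b Aa Ab]; first by rewrite conj1g; apply: sgrp1.
  by rewrite conjMg conjVg; apply: (proj2 sA).
by move=> a Aa; split; apply: H => // b /Nx[].
Qed.

Definition extension A x : set G :=
  [set y | exists a b, [/\ A a, generated [set x] b & y = a * b]].

Lemma extension_sgrp A x :
  subgroup_set A -> normalizes A x -> subgroup_set (extension A x).
Proof.
move=> sA Nx; have sx := generated_sgrp [set x]; 
split=> [|y1 y2 [a [b [Aa xb ->]]] [c [d [Ac xd ->]]]].
  by exists 1, 1; split; rewrite ?mulg1 //; exact: sgrp1.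
have xbd : generated [set x] (b * d^-1) by apply: sx.2.
exists (a * (c^-1) ^ (b * d^-1)^-1), (b * d^-1); split => //.
  apply: (sgrpM sA) => //.
  have Nbd : normalizes A (b * d^-1).
    by apply: generated_min xbd; [exact: normalizer_sgrp | move=> _ ->].
  by case: (Nbd c^-1) => //; apply: (sgrpV sA).
have cancel w : a * c^-1 ^ w^-1 * w = a * w * c^-1.
  by rewrite /conjg invgK !mulgA mulgVK.
by rewrite cancel invgM !mulgA.
Qed.

Lemma sub_extension A x : A `<=` extension A x.
Proof.
by move=> a Aa; exists a, 1; split; rewrite ?mulg1 //; apply: sgrp1; exact: generated_sgrp.
Qed.

Lemma extension_gen A x : subgroup_set A -> extension A x x.
Proof.
move=> sA; exists 1, x; split; rewrite ?mul1g //; first exact: sgrp1.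
exact: sub_generated.
Qed.

Lemma extension_min A B x : subgroup_set B -> A `<=` B -> B x -> extension A x `<=` B.
Proof.
move=> sB AB Bx y [a [b [Aa xb ->]]]; apply: (sgrpM sB); first exact: AB.
by apply: generated_min xb => // _ ->.
Qed.

(** As [a] normalizes [A], the elements [a] and [a * u] agree modulo [A], hence so do their
    powers. *)
Lemma normalized_expM A a u n :
  subgroup_set A -> normalizes A a -> A u -> A (a ^- n * (a * u) ^+ n).
Proof.
move=> sA Na Au; elim: n => [|n IH]; first by rewrite !expg0 mulg1 invg1; apply: sgrp1.
have -> : a ^- n.+1 * (a * u) ^+ n.+1 = (a ^- n * (a * u) ^+ n) ^ a * u.
  by rewrite (expgSr (a * u)) (expgSr a) /conjg invgM !mulgA.
by apply: sgrpM => //; case: (Na _ IH).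
Qed.

End Normalizes.

(** * The lower central series *)

Section LowerCentral.
Variable G : groupType.

Lemma lower_central_normal n : normal_set (lower_central G n).
Proof.
elim: n => [|n [sn Nn]] /=; first by [].
split=> [|x y]; first exact: generated_sgrp.
suff Ny : normalizes [set [~ x, y] | x in lower_central G n & y in [set: G]] y.
  by move=> /(normalizes_generated Ny)[].
move=> _ [a La] [b _] <-; rewrite !conjRg; split.
  by exists (a ^ y); [exact: Nn | exists (b ^ y)].
by exists (a ^ y^-1); [exact: Nn | exists (b ^ y^-1)].
Qed.

Lemma lower_centralR n x y :
  lower_central G n x -> lower_central G n.+1 [~ x, y].
Proof. by move=> Lx; apply: sub_generated; exists x => //; exists y. Qed.

Lemma lower_centralS n : lower_central G n.+1 `<=` lower_central G n.
Proof.
have [sn Nn] := lower_central_normal n.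
apply: generated_min => // _ [a La] [b _] <-; rewrite commgEl.
by apply: sgrpM => //; [exact: sgrpV | exact: Nn].
Qed.

Lemma lower_central_le m n :
  (m <= n)%N -> lower_central G n `<=` lower_central G m.
Proof.
move=> /subnK <-; elim: (n - m)%N => [|k IH] //.
by rewrite addSn => x /lower_centralS /IH.
Qed.

End LowerCentral.

Lemma lower_central_morph (M G : groupType) (f : UMagmaMorphism.type M G) n x :
  lower_central M n x -> lower_central G n (f x).
Proof.
elim: n x => [|n IH] x //=.
apply: (@generated_min _ _ (f @^-1` lower_central G n.+1)) => [|_ [a La] [b _] <-].
  by apply: preimage_sgrp; apply: (lower_central_normal _ _).1.
rewrite /= gmulfR; apply: lower_centralR; exact: IH.
Qed.

(** * One step of the chain, from [A] to [A <x>] *)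

Section Step.
Variables (G : groupType) (p : nat) (A U : set G) (x : G) (c e : nat).
Hypothesis p_pr : prime p.
Hypothesis sA : subgroup_set A.
Hypothesis NAx : normalizes A x.
Hypothesis sU : subgroup_set U.
Hypothesis UA : U `<=` A.
Hypothesis powU : forall a, A a -> U (a ^+ (p ^ e)).
Hypothesis LU : lower_central G c `<=` U.

(** Unlike [U], which [x] need not normalize, [U0] is normalized by every element normalizing [A],
    since conjugation by such an element preserves the generating set [S]. *)
Let S : set G := [set y | lower_central G c y \/ exists2 a, A a & y = a ^+ (p ^ e)].
Let U0 := generated S.

Let sU0 : subgroup_set U0. Proof. exact: generated_sgrp. Qed.

Let U0U : U0 `<=` U.
Proof. by apply: generated_min => // y [/LU//|[a Aa ->]]; apply: powU. Qed.

Let powU0 a : A a -> U0 (a ^+ (p ^ e)).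
Proof. by move=> Aa; apply: sub_generated; right; exists a. Qed.

Let LU0 : lower_central G c `<=` U0.
Proof. by move=> a La; apply: sub_generated; left. Qed.

Let NU0 b : normalizes A b -> normalizes U0 b.
Proof.
move=> Nb; apply: normalizes_generated => y [Ly|[a Aa ->]].
  by split; left; apply: (lower_central_normal G c).2.
case: (Nb _ Aa) => Aab Aab'.
by split; right; [exists (a ^ b) | exists (a ^ b^-1)]; rewrite ?conjXg.
Qed.

Let NU0A a : A a -> normalizes U0 a.
Proof. by move=> Aa; apply: NU0; apply: normalizes_self. Qed.

Let NU0x : normalizes U0 x. Proof. exact: NU0. Qed.

(** With [s = x ^+ (p ^ (i * e))], the commutator [d = [~ a, s]] lies one term deeper than [a], so
    by induction [s] centralizes it modulo [U0]. Thus [a ^ (s ^+ n)] is [a * d ^+ n] modulo [U0],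
    and for [n = p ^ e] the factor [d ^+ n] is in [U0]. *)
Let comm_pow i a : (i <= c)%N -> A a -> lower_central G (c - i) a ->
  U0 [~ a, x ^+ (p ^ (i * e))].
Proof.
elim: i a => [|i IH] a.
  rewrite subn0 => _ Aa La; rewrite mul0n expn0 expg1.
  by apply: LU0; apply: lower_centralS; apply: lower_centralR.
move=> lt_ic Aa La; set s := x ^+ (p ^ (i * e)).
have NAs : normalizes A s by exact: (sgrpX (normalizer_sgrp A)).
set d := [~ a, s].
have Ad : A d.
  by rewrite /d commgEl; apply: (sgrpM sA) => //; [exact: (sgrpV sA) | case: (NAs a Aa)].
have Ld : lower_central G (c - i) d.
  by rewrite -[(c - i)%N]prednK ?subn_gt0 // -subnS; apply: lower_centralR.
have Uds : U0 [~ d, s] by apply: IH => //; exact: ltnW.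
have conj_pow n : U0 ((a * d ^+ n)^-1 * a ^ (s ^+ n)).
  elim: n => [|n IHn]; first by rewrite !expg0 conjg1 mulg1 mulVg; apply: (sgrp1 sU0).
  set u := _ * _ in IHn.
  have Eu : a ^ (s ^+ n) = a * d ^+ n * u by rewrite /u mulVKg.
  have -> : a ^ (s ^+ n.+1) = (a * d) * (d * [~ d, s]) ^+ n * u ^ s.
    have aE : a * d = a ^ s by rewrite /d commgEl mulVKg.
    have dE : d * [~ d, s] = d ^ s by rewrite (commgEl d) mulVKg.
    by rewrite expgSr conjgM Eu (conjMg _ u) (conjMg a) conjXg -aE -dE.
  have -> : (a * d ^+ n.+1)^-1 * (a * d * (d * [~ d, s]) ^+ n * u ^ s) =
            (d ^- n * (d * [~ d, s]) ^+ n) * u ^ s.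
    by rewrite expgS !invgM !mulgA !mulgVK.
  apply: (sgrpM sU0) => //; last by case: (NU0 NAs IHn).
  by apply: (normalized_expM _ sU0) => //; apply: NU0A.
rewrite mulSn addnC expnD expgnA -/s.
have := conj_pow (p ^ e)%N.
set t := s ^+ _; rewrite invgM => H.
have -> : [~ a, t] = d ^+ (p ^ e) * (d ^- (p ^ e) * a^-1 * a ^ t).
  by rewrite commgEl !mulgA mulgV mul1g.
by apply: (sgrpM sU0) => //; exact: powU0.
Qed.

Let k0 := (c * e)%N.

(** At [i = c] the depth condition of [comm_pow] is vacuous, as term [0] of the series is [G].
    Powers of an element commuting with [a] modulo [U0] still do so. *)
Let comm_large k a : (k0 <= k)%N -> A a -> U0 [~ a, x ^+ (p ^ k)].
Proof.
move=> le_k Aa.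
have L0 : U0 [~ a, x ^+ (p ^ k0)] by apply: comm_pow => //; rewrite subnn.
rewrite -(subnKC le_k) expnD expgnA; set s := x ^+ _ in L0 *.
have NAs : normalizes A s by exact: (sgrpX (normalizer_sgrp A)).
elim: (p ^ (k - k0))%N => [|n IH]; first by rewrite expg0 commg1; exact: (sgrp1 sU0).
have -> : [~ a, s ^+ n.+1] = [~ a, s] * [~ a, s ^+ n] ^ s.
    by rewrite expgSr /commg /conjg !invgM !mulgA !mulgK.
by apply: (sgrpM sU0) => //; case: (NU0 NAs IH).
Qed.

(* If [x ^+ n] lies in [A] then [x ^+ (p ^ k)] meets [A] in a subgroup whose
   elements have prime-to-[p] powers in [U0], once [k] absorbs the [p]-part of
   [n]; being also of exponent [p ^ e] modulo [U0], they lie in [U0]. *)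
Let cyclic_meet : exists k1, forall k, (k1 <= k)%N -> forall b,
  generated [set x ^+ (p ^ k)] b -> A b -> U0 b.
Proof.
have reduce k : (forall n, A (x ^+ (p ^ k * n)) -> U0 (x ^+ (p ^ k * n))) ->
    forall b, generated [set x ^+ (p ^ k)] b -> A b -> U0 b.
  move=> H b /cycle_setP[n [->|->]]; rewrite ?expVgn -!expgnA; first exact: H.
  by move=> /(sgrpV sA); rewrite invgK => /H /(sgrpV sU0).
have [[n n_gt0 An]|noA] := EM (exists2 n, (0 < n)%N & A (x ^+ n)); last first.
  (* No positive power of [x] lies in [A], so only the exponent [0] remains. *)
  exists 0%N => k _; apply: reduce => -[|n] An.
    by rewrite muln0 expg0; exact: (sgrp1 sU0).
  case: noA; exists (p ^ k * n.+1)%N => //.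
  by rewrite muln_gt0 expn_gt0 prime_gt0.
exists (logn p n + e)%N => k le_k; apply: reduce => m Am.
set y := x ^+ _ in Am *.
pose q := (p ^ logn p n)%N.
have [n' nE] : exists n', n = (n' * q)%N.
  by exists (n %/ q)%N; rewrite divnK // pfactor_dvdnn.
have co : coprime (p ^ e) n'.
  have : ~~ (p %| n')%N.
    apply/negP => /dvdnP[j jE].
    have : (p ^ (logn p n).+1 %| n)%N by rewrite [X in (_ %| X)%N]nE jE -mulnA expnS dvdn_mull.
    by rewrite pfactor_dvdn // ltnn.
  by rewrite -prime_coprime // => /coprimeXl->.
(* [p ^ k] supplies the factor [q] turning [n'] into [n], and a factor [p ^ e] that sends [x ^+ n]
   into [U0]. *)
have Uy1 : U0 (y ^+ n').
  rewrite /y -expgnA -(subnKC le_k) !expnD.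
  have -> : (p ^ logn p n * p ^ e * p ^ (k - (logn p n + e)) * m * n' =
             n * (p ^ e * (p ^ (k - (logn p n + e)) * m)))%N.
    rewrite -/q; set r := (p ^ (k - _))%N; set t := (p ^ e)%N.
    by rewrite [in RHS]nE; lia.
  by rewrite !expgnA; apply: (sgrpX sU0) => //; apply: (sgrpX sU0) => //; apply: powU0.
have Uy2 : U0 (y ^+ (p ^ e)) by exact: powU0.
(* Bezout for the coprime exponents [p ^ e] and [n']: both powers of [y] lie in [U0], hence so does
   [y]. *)
have := egcdnP n' (_ : 0 < p ^ e)%N; rewrite expn_gt0 prime_gt0 // => /(_ isT)[u v uvE _].
have : U0 (y ^+ (u * p ^ e)) by rewrite mulnC expgnA; apply: (sgrpX sU0).
rewrite uvE (eqP (_ : gcdn (p ^ e) n' == 1%N)) // addn1 expgSr.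
by apply: (sgrpMl sU0) => //; rewrite mulnC expgnA; apply: (sgrpX sU0).
Qed.

(** Take [V = U0 <s>] with [s = x ^+ (p ^ k)]. For [k] at least [k0], [s] centralizes [A] modulo
    [U0], and it commutes with [x], so [V] is normal in [A <x>]. For [k] at least [k1], [<s>] meets
    [A] inside [U0], so [V] does too. *)
Lemma extension_step : exists (V : set G) (f : nat),
  [/\ subgroup_set V, V `<=` extension A x,
      forall b, extension A x b -> V (b ^+ (p ^ f)) &
      lower_central G c `<=` V] /\
  (forall a b, V a -> extension A x b -> V (a ^ b)) /\ V `&` A `<=` U.
Proof.
have [k1 Hk1] := cyclic_meet; pose k := maxn k0 k1.
pose s := x ^+ (p ^ k); pose V := extension U0 s.
have NxP B y : normalizes B x -> generated [set x] y -> normalizes B y.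
  by move=> NB; apply: generated_min => [|_ ->//]; exact: normalizer_sgrp.
have cs : generated [set x] s.
  by apply: (sgrpX (generated_sgrp _)); exact: sub_generated.
have sV : subgroup_set V by apply: extension_sgrp => //; apply: NxP.
have U0V : U0 `<=` V by exact: sub_extension.
have Vs : V s by exact: extension_gen.
have NVA a : A a -> normalizes V a.
  have H a' : A a' -> forall v, V v -> V (v ^ a').
    move=> Aa' v [u [b [Uu sb ->]]]; rewrite conjMg; apply: (sgrpM sV).
      by apply: U0V; case: (NU0A Aa' Uu).
    apply: (@generated_min _ [set s] [set b | V (b ^ a')]) sb.
      split=> [|y z /= Vy Vz]; first by rewrite /= conj1g; exact: (sgrp1 sV).
      by rewrite conjMg conjVg; apply: sV.2.
    move=> _ -> /=; have -> : s ^ a' = s * [~ a', s]^-1.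
      by rewrite invgR commgEl mulVKg.
    apply: (sgrpM sV) => //; apply: U0V; apply: (sgrpV sU0); apply: comm_large => //.
    exact: leq_maxl.
  by move=> Aa v Vv; split; apply: H => //; apply: (sgrpV sA).
have NVx : normalizes V x.
  have E y : generated [set x] y -> s ^ y = s.
    have cx : commute s x by apply: commute_sym; apply: commuteX; exact: commute_refl.
    move=> /cycle_setP[n [->|->]]; rewrite /conjg.
      by rewrite (commuteX n cx) mulKg.
    by rewrite (commuteX n (commuteV cx)) mulKg.
  have H y : generated [set x] y -> forall v, V v -> V (v ^ y).
    move=> xy v [u [b [Uu sb ->]]]; rewrite conjMg; apply: (sgrpM sV).
      by apply: U0V; case: (NxP _ _ NU0x xy _ Uu).
    move: sb => /cycle_setP[n [->|->]]; rewrite conjXg ?conjVg E //; apply: (sgrpX sV) => //.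
    exact: (sgrpV sV).
  move=> v Vv; have gx : generated [set x] x by exact: sub_generated.
  by split; apply: H => //; exact: (sgrpV (generated_sgrp _)).
have NV b : extension A x b -> normalizes V b.
  by apply: extension_min => //; exact: normalizer_sgrp.
exists V, (k + e)%N; split; first split=> //.
- apply: extension_min; first exact: extension_sgrp.
    by move=> u Uu; apply: sub_extension; apply: UA; apply: U0U.
  by apply: (sgrpX (extension_sgrp sA NAx)); exact: extension_gen.
- move=> b Bb; rewrite expnD expgnA.
  (* For [b] the product of an element of [A] and a power [y] of [x] or [x^-1], [b ^+ (p ^ k)] and
     [y ^+ (p ^ k)] agree modulo [A], and the latter lies in [<s>]. A further [p ^ e]-th power sends
     the factor [a] into [U0]. *)
  have [a Aa [v Vv ->]] : exists2 a, A a & exists2 v, V v & b ^+ (p ^ k) = a * v.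
    case: Bb => a [y [Aa xy ->]].
    exists ((a * y) ^+ (p ^ k) * y ^- (p ^ k)).
      have -> : a * y = y * a ^ y by rewrite /conjg !mulgA mulgV mul1g.
      have := normalized_expM (p ^ k) sA (NxP _ _ NAx xy) (NxP _ _ NAx xy _ Aa).1.
      have Ny : normalizes A (y ^+ (p ^ k)).
        by apply: (sgrpX (normalizer_sgrp A)); exact: NxP xy.
      by move=> /Ny[_]; rewrite /(_ ^ _^-1) invgK !mulgA mulgV mul1g.
    exists (y ^+ (p ^ k)); last by rewrite mulgVK.
    by move: xy => /cycle_setP[n [->|->]]; rewrite ?expVgn -?expgnA mulnC expgnA;
       [|apply: (sgrpV sV)]; apply: (sgrpX sV).
  have := normalized_expM (p ^ e) sV (NVA _ Aa) Vv.
  by apply: (sgrpMl sV); apply: (sgrpV sV); apply: U0V; exact: powU0.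
- by move=> a /LU0 /U0V.
split=> [a b Va Bb|_ [[u [b [Uu sb ->]]] Aub]]; first by case: (NV b Bb a Va).
apply: U0U; apply: (sgrpM sU0) => //; apply: (Hk1 k) sb _; first exact: leq_maxr.
by apply: (sgrpMl sA) Aub => //; apply: UA; apply: U0U.
Qed.

End Step.

(** * Finitely generated nilpotent groups *)

Section NilpotentChain.
Variable G : groupType.
Hypothesis fgG : finitely_generated G.

Lemma commgMr (x y z : G) : [~ x, y * z] = [~ x, z] * [~ x, y] ^ z.
Proof. by rewrite /commg /conjg !invgM !mulgA !mulgK. Qed.

Lemma commgMl (x y z : G) : [~ x * y, z] = [~ x, z] ^ y * [~ y, z].
Proof. by rewrite /commg /conjg !invgM !mulgA !mulgK. Qed.

(* Modulo [lower_central G j.+2] the commutator is bimultiplicative on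
   [lower_central G j] and [G]. *)
Lemma lower_central_fg j : exists s : seq G,
  (forall x, x \in s -> lower_central G j x) /\
  forall K, subgroup_set K -> (forall x, x \in s -> K x) ->
    lower_central G j.+1 `<=` K -> lower_central G j `<=` K.
Proof.
have [S genS] := fgG.
elim: j => [|j [s [Ls gens]]].
  exists S; split=> // K sK SK _ x _; have: generated [set` S] x by rewrite genS.
  by apply: generated_min x => // x; exact: SK.
exists [seq [~ x, y] | x <- s, y <- S]; split=> [_ /allpairsP[[x y] [xs _ ->]]|].
  by apply: lower_centralR; exact: Ls.
move=> K sK sSK LK.
have [sL0 _] := lower_central_normal G j.
have KJ d z : lower_central G j.+1 d -> K d -> K (d ^ z).
  move=> Ld Kd; rewrite -[d ^ z](mulVKg d) -commgEl; apply: (sgrpM sK) => //.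
  by apply: LK; exact: lower_centralR.
have KR x y : lower_central G j x -> K [~ x, y] -> K [~ x, y^-1].
  move=> Lx Kxy.
  have: K ([~ x, y^-1] * [~ x, y] ^ y^-1).
    by rewrite -commgMr mulgV commg1; exact: (sgrp1 sK).
  by apply: (sgrpMr sK); apply: KJ => //; exact: lower_centralR.
have KLR x : x \in s -> forall y, K [~ x, y].
  move=> xs y; have Lx := Ls x xs.
  suff: generated [set` S] `<=` [set y | K [~ x, y]] by rewrite genS; apply.
  apply: generated_min => [|z zS]; last by apply: sSK; apply: allpairs_f.
  split=> [|u v Ku Kv] /=; first by rewrite commg1; exact: (sgrp1 sK).
  rewrite commgMr; apply: (sgrpM sK); first exact: KR.
  by apply: KJ => //; exact: lower_centralR.
(* [gens] is applied to the subgroup of those [x] in term [j] whose commutators all lie in [K]. *)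
suff KL : lower_central G j `<=` [set x | lower_central G j x /\ forall z, K [~ x, z]].
  by apply: generated_min => // _ [a La] [b _] <-; case: (KL a La).
apply: gens => [|x xs|x Lx] /=; last first.
- by split=> [|z]; [exact: lower_centralS | apply: LK; exact: lower_centralR].
- by split=> [|z]; [exact: Ls | exact: KLR].
split=> [|x y [Lx Kx] [Ly Ky]].
  by split=> [|z]; rewrite ?comm1g; [exact: (sgrp1 sL0) | exact: (sgrp1 sK)].
have LyV := sgrpV sL0 Ly.
split=> [|z]; first exact: (sgrpM sL0).
rewrite commgMl; apply: (sgrpM sK).
  by apply: KJ => //; exact: lower_centralR.
have: K ([~ y, z] ^ y^-1 * [~ y^-1, z]).
  by rewrite -commgMl mulgV comm1g; exact: (sgrp1 sK).
by apply: (sgrpMl sK); apply: KJ => //; exact: lower_centralR.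
Qed.

(** A subgroup containing term [j.+1] of the lower central series is normalized by term [j], so the
    finitely many elements given by [lower_central_fg] can be adjoined one at a time. The result
    contains term [j], and one descends from [c] to [0]. *)
Lemma nilpotent_chain_ind (c : nat) (H : set G) (P : set G -> Prop) :
  subgroup_set H -> lower_central G c `<=` H -> P H ->
  (forall A x, subgroup_set A -> H `<=` A -> normalizes A x -> P A ->
     P (extension A x)) ->
  P setT.
Proof.
move=> sH LH PH Pext.
suff main j A : subgroup_set A -> H `<=` A -> lower_central G j `<=` A ->
  P A -> P setT by exact: (main c H).
elim: j A => [|j IH] A sA HA LA PA.
  by have <- : A = [set: G] by apply/seteqP; split=> // x _; exact: LA.
have [s [Ls gens]] := lower_central_fg j.
have [sL NL] := lower_central_normal G j.
suff [B [sB AB PB sBs]] : exists B, [/\ subgroup_set B, A `<=` B, P B &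
    forall x, x \in s -> B x].
  by apply: (IH B) => // x; [move=> /HA /AB | apply: gens => // y /LA /AB].
elim: s Ls {gens} => [|x s IHs] Ls; first by exists A; split.
have [|B [sB AB PB sBs]] := IHs; first by move=> y ys; apply: Ls; rewrite inE ys orbT.
have Lx : lower_central G j x by apply: Ls; rewrite inE eqxx.
have NB y : lower_central G j y -> forall b, B b -> B (b ^ y).
  move=> Ly b Bb; rewrite -[b ^ y](mulVKg b) -commgEl; apply: (sgrpM sB) => //.
  by apply/AB/LA; rewrite -invgR; apply: (sgrpV (lower_central_normal G j.+1).1);
     exact: lower_centralR.
have NBx : normalizes B x.
  by move=> b Bb; split; apply: NB => //; exact: (sgrpV sL).
exists (extension B x); split.
- exact: extension_sgrp.
- by move=> a /AB; exact: sub_extension.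
- by apply: Pext => // a /HA /AB.
move=> y; rewrite inE => /orP[/eqP->|/sBs]; first exact: extension_gen.
exact: sub_extension.
Qed.

(** [extension_step] is iterated along the chain. Each new subgroup meets the preceding term inside
    the preceding subgroup, so its intersection with [H] stays in [U]. *)
Lemma subgroup_pow_extension (p : nat) (H U : set G) (c e : nat) :
  prime p -> subgroup_set H -> subgroup_set U -> U `<=` H ->
  (forall u h, U u -> H h -> U (u ^ h)) ->
  (forall h, H h -> U (h ^+ (p ^ e))) -> lower_central G c `<=` U ->
  exists (V : set G) (f : nat),
    [/\ normal_set V, forall g, V (g ^+ (p ^ f)), lower_central G c `<=` V &
        V `&` H `<=` U].
Proof.
move=> p_pr sH sU UH NU powU LU.
suff [V [f [[sV _ powV LV] [NV VHU]]]] : exists (V : set G) (f : nat),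
  [/\ subgroup_set V, V `<=` setT, forall b, setT b -> V (b ^+ (p ^ f)) &
      lower_central G c `<=` V] /\
  (forall a b, V a -> setT b -> V (a ^ b)) /\ V `&` H `<=` U.
  by exists V, f; split=> // [|g]; [split=> // x y Vx; exact: NV | exact: powV].
pose P B := exists (V : set G) (f : nat),
  [/\ subgroup_set V, V `<=` B, forall b, B b -> V (b ^+ (p ^ f)) &
      lower_central G c `<=` V] /\
  (forall a b, V a -> B b -> V (a ^ b)) /\ V `&` H `<=` U.
apply: (@nilpotent_chain_ind c H P) => //.
- by move=> x /LU /UH.
- by exists U, e; split=> //; split=> // x [].
move=> A x sA HA NAx [V [f [[sV VA powV LV] [_ VHU]]]].
have [W [f' [[sW WA powW LW] [NW WV]]]] := extension_step p_pr sA NAx sV VA powV LV.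
exists W, f'; split=> //; split=> // y [Wy Hy]; apply: VHU; split=> //.
by apply: WV; split=> //; exact: HA.
Qed.

(** Along the chain from [V] to [G], adjoining [x] multiplies the number of cosets of [V] by at most
    [q], because [x ^+ q] lies in [V]. *)
Lemma subgroup_pow_finite_index (q c : nat) (V : set G) :
  (0 < q)%N -> subgroup_set V -> (forall g, V (g ^+ q)) ->
  lower_central G c `<=` V ->
  exists L : seq G, forall g, exists2 l, l \in L & V (g * l^-1).
Proof.
move=> q_gt0 sV powV LV.
pose P A := exists L : seq G, forall g, A g -> exists2 l, l \in L & V (g * l^-1).
suff [L HL] : P setT by exists L => g; exact: HL.
apply: (@nilpotent_chain_ind c V P) => //.
  by exists [:: 1] => g Vg; exists 1; rewrite ?inE // divg1.
move=> A x sA VA NAx [L HL].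
exists [seq l * x ^+ j | l <- L, j <- iota 0 q] => _ [a [b [Aa xb ->]]].
have [m [v Vv ->]] : exists m, exists2 v, V v & b = v * x ^+ m.
  move: xb => /cycle_setP[n [->|->]].
    by exists n, 1; rewrite ?mul1g //; exact: (sgrp1 sV).
  (* A negative power is made nonnegative modulo [V]: [x ^- n] is [(x ^- n) ^+ q] times
     [x ^+ (n * q.-1)]. *)
  exists (n * q.-1)%N, (x ^- n ^+ q); first exact: powV.
  rewrite -[x ^- n]expVgn -!expgnA; have -> : (n * q = n + n * q.-1)%N.
    by rewrite -mulnS prednK.
  by rewrite expgnDr !expVgn mulgVK.
have [l lL Vl] : exists2 l, l \in L & V (a * (v * x ^+ q ^+ (m %/ q)) * l^-1).
  apply: HL; apply: (sgrpM sA) => //; apply: VA; apply: (sgrpM sV) => //.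
  exact: (sgrpX sV).
exists (l * x ^+ (m %% q)).
  by apply: allpairs_f => //; rewrite mem_iota ltn_mod.
rewrite {1}(divn_eq m q) expgnDr mulnC expgnA invgM.
by rewrite !mulgA mulgK -!mulgA; rewrite !mulgA in Vl *.
Qed.

End NilpotentChain.

(** * Finite p-groups *)

Section FiniteGroup.
Variables (G : groupType) (s : seq G).
Hypothesis s_all : forall x : G, x \in s.

(** An alias of [G] that the enumeration makes a finite group, giving access to the theorems of
    Lagrange and Cauchy. *)
Definition enumerated_group of (forall x : G, x \in s) : Type := G.
Local Notation T := (enumerated_group s_all).

HB.instance Definition _ := Group.on T.

Fact enumerated_group_pickleK :
  pcancel (fun x : T => index x s) (fun n => onth s n : option T).
Proof. move=> x; rewrite onthE (nth_map x) ?nth_index ?index_mem //; exact: s_all. Qed.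

HB.instance Definition _ :=
  @isCountable.Build T _ _ enumerated_group_pickleK.

Fact enumerated_group_enumP : Finite.axiom (undup s : seq T).
Proof. by move=> x; rewrite count_uniq_mem ?undup_uniq // mem_undup s_all. Qed.

HB.instance Definition _ := isFinite.Build T enumerated_group_enumP.

Lemma enumerated_card : [set: G] #= `I_#|{: T}|.
Proof.
apply/card_set_bijP; exists (fun x => enum_rank (x : T) : nat); split.
- by move=> x _ /=.
- by move=> x y _ _ /val_inj /enum_rank_inj.
by move=> n /= ltn; exists (enum_val (Ordinal ltn)) => //; rewrite enum_valK.
Qed.

End FiniteGroup.

(** Lagrange's theorem gives the exponent. Conversely, by Cauchy's theorem a prime dividing the
    order is the order of an element, so it divides [p ^ e] and equals [p]. *)
Lemma finite_pgroupP (p : nat) (G : groupType) : prime p ->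
  finite_pgroup p G <->
  (exists s : seq G, forall x, x \in s) /\ exists e, forall x : G, x ^+ (p ^ e) = 1.
Proof.
move=> p_pr; split=> [[k cardG]|[[s s_all] [e expG]]].
  have /finite_seqP[s sE] : finite_set [set: G] by exists (p ^ k)%N.
  have s_all x : x \in s by have : [set: G] x by []; rewrite sE.
  split; first by exists s.
  exists k => x; have <- : #|{: enumerated_group s_all}| = (p ^ k)%N.
    by apply/card_eq_II; rewrite -(card_eql (enumerated_card s_all)).
  rewrite -cardsT.
  by apply: (@expg_cardG (enumerated_group s_all) [group of [set: _]%SET]); rewrite inE.
pose T : finGroupType := enumerated_group s_all.
have pT : pgroup p [set: T]%SET.
  apply/pgroupP => q q_pr /(Cauchy q_pr)[x _ xq].
  have : #[x] %| p ^ e by rewrite order_dvdn; apply/eqP; exact: expG.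
  by rewrite xq Euclid_dvdX // => /andP[]; rewrite dvdn_prime2.
exists (logn p #|[set: T]%SET|); rewrite -(card_pgroup pT) cardsT.
exact: enumerated_card.
Qed.

(** * Kernels meeting a polycyclic subgroup trivially *)

Section QuotientMap.
Variables (G : groupType) (N : normalClosed G).

Definition quotgrp_map (x : G) : quotgrp N := \pi_(quotgrp N) x.

Fact quotgrp_map_morphism : monoid_morphism quotgrp_map.
Proof. by split=> // x y; rewrite /quotgrp_map -quotgrp_mulE. Qed.

HB.instance Definition _ :=
  isUMagmaMorphism.Build G (quotgrp N) quotgrp_map quotgrp_map_morphism.

Lemma quotgrp_map_eq x y : quotgrp_map x = quotgrp_map y <-> x^-1 * y \in N.
Proof. by split=> [/quotgrp_eqP|h]; last exact/quotgrp_eqP. Qed.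

Lemma quotgrp_map_eq1 x : quotgrp_map x = 1 <-> x \in N.
Proof.
rewrite (_ : 1 = quotgrp_map 1) //; split=> [/esym|Nx].
  by move=> /quotgrp_map_eq; rewrite invg1 mul1g.
by apply: esym; apply/quotgrp_map_eq; rewrite invg1 mul1g.
Qed.

Lemma quotgrp_map_surj (u : quotgrp N) : exists x, u = quotgrp_map x.
Proof. by elim/quotW: u => x; exists x. Qed.

End QuotientMap.

Section IsolatedKernel.
Variable G : groupType.

(** These conditions say that [G / N] is torsion-free and nilpotent, phrased inside [G] so that such
    [N] are easily intersected. *)
Definition torsion_free_nilpotent_kernel (N : set G) : Prop :=
  [/\ normal_set N, forall x n, (0 < n)%N -> N (x ^+ n) -> N x &
      exists c, lower_central G c `<=` N].

Lemma residual_kernel (g : G) :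
  residually_torsion_free_nilpotent G -> g <> 1 ->
  exists N, torsion_free_nilpotent_kernel N /\ ~ N g.
Proof.
move=> rG /rG[N [gN tfN [c nilN]]]; exists [set` N]; split; last exact/negP.
split; first exact: normal_set_pred.
  move=> x n n_gt0 /= /quotgrp_map_eq1 xn1; apply/quotgrp_map_eq1.
  by apply: (tfN _ n) => //; rewrite -gmulfXn.
exists c => x Lx /=; apply/quotgrp_map_eq1.
have := lower_central_morph (@quotgrp_map G N) Lx; rewrite nilN; exact.
Qed.

Lemma kernelI (N1 N2 : set G) :
  torsion_free_nilpotent_kernel N1 -> torsion_free_nilpotent_kernel N2 ->
  torsion_free_nilpotent_kernel (N1 `&` N2).
Proof.
move=> [[s1 J1] i1 [c1 L1]] [[s2 J2] i2 [c2 L2]]; split.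
- split; last by move=> x y [? ?]; split; [exact: J1 | exact: J2].
  split; first by split; [exact: (sgrp1 s1) | exact: (sgrp1 s2)].
  by move=> x y [? ?] [? ?]; split; [apply: s1.2 | apply: s2.2].
- by move=> x n n_gt0 [? ?]; split; [exact: (i1 x n) | exact: (i2 x n)].
exists (maxn c1 c2) => x Lx; split.
  by apply: L1; apply: (lower_central_le (leq_maxl c1 c2)).
by apply: L2; apply: (lower_central_le (leq_maxr c1 c2)).
Qed.

Lemma residually_tfn_torsion_free :
  residually_torsion_free_nilpotent G -> torsion_free G.
Proof.
move=> rG x n n_gt0 xn1; apply: contrapT => /(residual_kernel rG)[N [[[sN _] iN _] Nx]].
by apply: Nx; apply: (iN x n) => //; rewrite xn1; exact: (sgrp1 sN).
Qed.

End IsolatedKernel.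

(** If [u] and [v] are powers of a generator with exponents [k] and [l] up to sign, then [u ^+ l]
    and [v ^+ k] both have exponent [k * l] up to sign. The first alternative is [l = 0]. *)
Lemma cyclic_commensurable (Q : groupType) (u v : Q) : cyclic_group Q ->
  (exists2 n, (0 < n)%N & v ^+ n = 1) \/
  exists l m, (0 < l)%N /\ (u ^+ l = v ^+ m \/ u ^+ l = v ^- m).
Proof.
move=> [g genQ].
have gP w : exists n, w = g ^+ n \/ w = g^-1 ^+ n by apply/cycle_setP; rewrite genQ.
have [k uE] := gP u; have [[|l] vE] := gP v.
  by left; exists 1%N => //; rewrite expg1; case: vE => ->; rewrite expg0.
right; exists l.+1, k; split=> //.
pose w := g ^+ (k * l.+1).
have uwE : u ^+ l.+1 = w \/ u ^+ l.+1 = w^-1.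
  by case: uE => ->; rewrite -expgnA ?expVgn; [left | right].
have vwE : v ^+ k = w \/ v ^+ k = w^-1.
  by case: vE => ->; rewrite -expgnA (mulnC l.+1) ?expVgn; [left | right].
by case: uwE => ->; case: vwE => ->; rewrite ?invgK; auto.
Qed.

(** Serves to compare infinite factors: those of [B] are among those of [A], and if there are as
    many they are the same. *)
Lemma count_eq_sub (T : eqType) (s : seq T) (P Q : pred T) :
  subpred P Q -> (count Q s <= count P s)%N -> {in s, subpred Q P}.
Proof.
move=> PQ; elim: s => [|x s IH] //= le_s y.
have le1 := sub_count PQ s; have {IH} IH' := IH.
rewrite inE => /orP[/eqP->|ys] Qy.
  by case Px: (P x) le_s => //; rewrite Qy /= add0n add1n ltnNge le1.
apply: IH' => //; case Px: (P x) le_s; first by rewrite (PQ _ Px) leq_add2l.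
by rewrite add0n; apply: leq_trans; rewrite leq_addl.
Qed.

(* The witness [d] is the Hirsch length: the number of infinite factors of the
   series induced on [A]. *)
Lemma polycyclic_rank (M : groupType) : polycyclic M ->
  exists d : set M -> nat, forall A B : set M,
    subgroup_set A -> subgroup_set B -> B `<=` A ->
    (forall x n, (0 < n)%N -> A x -> B (x ^+ n) -> B x) ->
    (d A <= d B)%N -> A `<=` B.
Proof.
move=> [n [K [K0 Kn HK]]].
pose infinite_factor (A : set M) i := exists a, [/\ A a, a \in K i.+1 &
  forall k, (0 < k)%N -> a ^+ k \notin K i].
exists (fun A => count (fun i => `[< infinite_factor A i >]) (iota 0 n)).
move=> A B sA sB BA isoB le_d.
have infB i : (i < n)%N -> infinite_factor A i -> infinite_factor B i.
  move=> lt_in Ai; apply/asboolP; 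
  have /asboolP {}Ai := Ai; move: i lt_in Ai => j lt_jn Aj.
  apply: (count_eq_sub _ le_d) Aj; last by rewrite mem_iota.
  by move=> k /asboolP[a [Ba Ka ak]]; apply/asboolP; exists a; split=> //; exact: BA.
suff H i : (i <= n)%N -> forall a, A a -> a \in K i -> B a.
  move=> a Aa; apply: (H n) => //; have : [set: M] a by []; by rewrite -Kn.
(* Climbing the series: if a power of [a] lies in [K i], isolation of [B] suffices; otherwise the
   factor is infinite on [A], hence on [B]. *)
elim: i => [_|i IH lt_in] a Aa Ka.
  have : [set` K 0%N] a by []; rewrite K0 => ->; exact: (sgrp1 sB).
have IH' := IH (ltnW lt_in).
have [KiS [N [NE cycN]]] := HK i lt_in.
have [[k k_gt0 Kak]|noak] := EM (exists2 k, (0 < k)%N & a ^+ k \in K i).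
  by apply: (isoB a k) => //; apply: IH' => //; exact: (sgrpX sA).
have [b [Bb Kb bk]] : infinite_factor B i.
  apply: infB => //; exists a; split=> // k k_gt0; apply/negP => Kak.
  by apply: noak; exists k.
pose a' := Subgrp Ka; pose b' := Subgrp Kb.
have := cyclic_commensurable (quotgrp_map N a') (quotgrp_map N b') cycN.
case=> [[k k_gt0]|[l [m [l_gt0 ablm]]]].
  rewrite -gmulfXn => /quotgrp_map_eq1; rewrite NE gmulfXn /= => bkK.
  by have := bk k k_gt0; rewrite bkK.
apply: (isoB a l) => //.
(* A positive power of [a] agrees modulo [K i] with a power [w] of [b] or of its inverse; the
   discrepancy lies in [A] and [K i], hence in [B] by induction. *)
have [w Bw Kw] : exists2 w, B w & a ^- l * w \in K i.
  case: ablm => ablm; [exists (b ^+ m) | exists (b ^- m)]; try exact: (sgrpX sB).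
  - move: ablm; rewrite -!gmulfXn => /quotgrp_map_eq.
    by rewrite NE gmulfM gmulfV !gmulfXn.
  - by apply: (sgrpV sB); exact: (sgrpX sB).
  move: ablm; rewrite -!gmulfXn -gmulfV => /quotgrp_map_eq.
  by rewrite NE gmulfM !gmulfV !gmulfXn.
have : B (a ^- l * w).
  apply: IH' => //; apply: (sgrpM sA); last exact: BA.
  by apply: (sgrpV sA); exact: (sgrpX sA).
by move=> /(sgrpMr sB Bw) /(sgrpV sB); rewrite invgK.
Qed.

(** Choose [N] whose preimage has minimal rank. If [f x] in [N] were nontrivial, intersecting with a
    kernel [N'] that avoids it could not lower the rank, so by [polycyclic_rank] the preimage would
    not shrink, although it loses [x]. *)
Lemma kernel_avoiding_polycyclic (M G : groupType) (f : UMagmaMorphism.type M G) :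
  polycyclic M -> residually_torsion_free_nilpotent G ->
  exists N, torsion_free_nilpotent_kernel N /\ forall x, N (f x) -> f x = 1.
Proof.
move=> /polycyclic_rank[d dP] rG.
pose P n := `[< exists N : set G, torsion_free_nilpotent_kernel N /\ d (f @^-1` N) = n >].
have exP : exists n, P n.
  exists (d (f @^-1` setT)); apply/asboolP; exists setT; split=> //.
  by split; [split | | exists 0%N].
case: (ex_minnP exP) => n /asboolP[N [kN <-]] min_d.
exists N; split=> // x Nfx; apply: contrapT => /(residual_kernel rG)[N' [kN' N'fx]].
have kI := kernelI kN kN'.
have sub : f @^-1` N `<=` f @^-1` (N `&` N').
  have [[sN _] _ _] := kN; have [[sI _] isoI _] := kI.
  apply: dP; try exact: preimage_sgrp.
  - by move=> y [].
  - by move=> y m m_gt0 _ /=; rewrite gmulfXn; exact: isoI.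
  by apply: min_d; apply/asboolP; exists (N `&` N').
by case: (sub x Nfx).
Qed.

(** Otherwise the cosets of [K] by the powers of [h] would be pairwise distinct. *)
Lemma finite_index_pow (M : groupType) (K : groupClosed M) (h : M) :
  finite_index K -> exists2 n, (0 < n)%N & h ^+ n \in K.
Proof.
move=> finK; apply: contrapT => noK.
pose g n := [set h ^+ n * k | k in [set` K]].
have lt_g i j : (i < j)%N -> g i <> g j.
  move=> lt_ij gij; apply: noK; exists (j - i)%N; first by rewrite subn_gt0.
  have : g i (h ^+ i) by exists 1; rewrite ?mulg1 //=; exact: gpred1.
  rewrite gij => -[k /= Kk hk].
  have kE : k = (h ^+ (j - i))^-1.
    by apply: (@mulgI _ (h ^+ j)); rewrite hk -{1}(subnKC (ltnW lt_ij)) expgnDr mulgK.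
  by rewrite -gpredV -kE.
have inj_g : injective g.
  move=> i j gij; case: (ltngtP i j) => // /lt_g; [|move/nesym]; exact.
apply: infinite_nat; rewrite -(eq_finite_set (inj_card_eq (f := g) _)); last first.
  by move=> i j _ _; exact: inj_g.
by apply: sub_finite_set finK => _ [i _ <-]; exists (h ^+ i).
Qed.

(** * The pro-p topology *)

(** Representatives and an exponent, both stated in [G], are easily pulled back along a morphism or
    combined for an intersection. *)
Lemma quotgrp_finite_pgroupP (p : nat) (G : groupType) (N : normalClosed G) :
  prime p -> finite_pgroup p (quotgrp N) <->
  (exists L : seq G, forall g, exists2 l, l \in L & l^-1 * g \in N) /\
  exists e, forall g : G, g ^+ (p ^ e) \in N.
Proof.
move=> p_pr; split=> [/(finite_pgroupP _ p_pr)|].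
  move=> [[s s_all] [e He]]; split.
    exists [seq repr u | u <- s] => g; exists (repr (quotgrp_map N g)).
      by rewrite map_f.
    by apply/quotgrp_map_eq; rewrite /quotgrp_map reprK.
  by exists e => g; apply/quotgrp_map_eq1; rewrite gmulfXn He.
move=> [[L HL] [e He]]; apply/finite_pgroupP => //; split.
  exists [seq quotgrp_map N l | l <- L] => u.
  have [g ->] := quotgrp_map_surj u; have [l lL /quotgrp_map_eq <-] := HL g.
  by rewrite map_f.
exists e => u; have [g ->] := quotgrp_map_surj u.
by rewrite -gmulfXn; apply/quotgrp_map_eq1.
Qed.

(** Meant for cosets whose given representatives [L] may lie outside the image of a morphism: one
    [t] is chosen for each [l] that occurs, and an arbitrary [t0] for the others. *)
Lemma finite_cover_choice (T : choiceType) (S : eqType) (R : T -> S -> Prop) (L : seq S) :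
  (forall t, exists2 l, l \in L & R t l) ->
  exists L' : seq T, forall t, exists2 t', t' \in L' & exists l, R t l /\ R t' l.
Proof.
move=> HL.
have [[t0 _]|noT] := EM (exists t : T, True); last first.
  by exists [::] => t; case: noT; exists t.
have [f fP] : {f : S -> T & forall l, (exists t, R t l) -> R (f l) l}.
  apply: (@choice _ _ (fun l t => (exists t', R t' l) -> R t l)) => l.
  have [[t Rt]|no] := EM (exists t, R t l); first by exists t.
  by exists t0 => /no.
exists [seq f l | l <- L] => t; have [l lL Rtl] := HL t.
exists (f l); first exact: map_f.
by exists l; split=> //; apply: fP; exists t.
Qed.

Section ProPNeighbourhoods.
Variables (p : nat) (p_pr : prime p).

Lemma finite_pgroup_preim (M G : groupType) (f : UMagmaMorphism.type M G)
    (V : normalClosed G) : finite_pgroup p (quotgrp V) ->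
  exists U : normalClosed M,
    finite_pgroup p (quotgrp U) /\ forall x, (x \in U) = (f x \in V).
Proof.
move=> /(quotgrp_finite_pgroupP _ p_pr)[[L HL] [e He]].
have nU : normal_set (f @^-1` [set` V]).
  split; first exact: preimage_sgrp (subgroup_set_pred V).
  by move=> x y /=; rewrite gmulfJ; exact: Defs.gpredJ.
have inU x : (x \in normalClosed_of nU) = (f x \in V).
  by apply/asboolP/idP.
exists (normalClosed_of nU); split=> //.
apply/quotgrp_finite_pgroupP => //; split; last first.
  by exists e => x; rewrite inU gmulfXn.
have [x|L' HL'] := @finite_cover_choice M G (fun x l => l^-1 * f x \in V) L.
  exact: HL.
exists L' => x; have [y yL' [l [Vlx Vly]]] := HL' x; exists y => //.
rewrite inU gmulfM gmulfV.
have -> : (f y)^-1 * f x = (l^-1 * f y)^-1 * (l^-1 * f x).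
  by rewrite invgM invgK mulgA mulgK.
by apply: gpredM => //; rewrite gpredV.
Qed.

Lemma finite_pgroupI (G : groupType) (V W : normalClosed G) :
  finite_pgroup p (quotgrp V) -> finite_pgroup p (quotgrp W) ->
  exists U : normalClosed G,
    finite_pgroup p (quotgrp U) /\ forall x, (x \in U) = (x \in V) && (x \in W).
Proof.
move=> /(quotgrp_finite_pgroupP _ p_pr)[[L HL] [e He]].
move=> /(quotgrp_finite_pgroupP _ p_pr)[[L2 HL2] [e2 He2]].
have nU : normal_set [set x | (x \in V) && (x \in W)].
  split=> [|x y /andP[Vx Wx]]; last by rewrite /= !Defs.gpredJ.
  split=> [|x y /andP[Vx Wx] /andP[Vy Wy]]; first by rewrite /= !gpred1.
  by rewrite /= !gpredF.
have inU x : (x \in normalClosed_of nU) = (x \in V) && (x \in W).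
  exact: asboolb.
exists (normalClosed_of nU); split=> //.
apply/quotgrp_finite_pgroupP => //; split; last first.
  by exists (e + e2)%N => x; rewrite inU expnD {1}expgnA gpredXn //= mulnC expgnA gpredXn.
(* A label is a pair of cosets, one modulo [V] and one modulo [W]. *)
pose R x (l : G * G) := (l.1^-1 * x \in V) && (l.2^-1 * x \in W).
have [x|L' HL'] := @finite_cover_choice G (G * G)%type R (allpairs pair L L2).
  have [l lL Vx] := HL x; have [l2 lL2 Wx] := HL2 x.
  by exists (l, l2); rewrite ?allpairs_f // /R Vx.
exists L' => x; have [y yL' [l [/andP[Vlx Wlx] /andP[Vly Wly]]]] := HL' x; exists y => //.
have E l' : y^-1 * x = (l'^-1 * y)^-1 * (l'^-1 * x).
  by rewrite invgM invgK mulgA mulgK.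
by rewrite inU; apply/andP; split; [rewrite (E l.1) | rewrite (E l.2)];
   apply: gpredM; rewrite ?gpredV.
Qed.

Lemma finite_pgroupT (G : groupType) :
  exists U : normalClosed G, finite_pgroup p (quotgrp U) /\ forall x, x \in U.
Proof.
have nT : normal_set [set: G] by [].
exists (normalClosed_of nT); have inT x : x \in normalClosed_of nT by apply/asboolP.
split=> //; apply/quotgrp_finite_pgroupP => //; split; last by exists 0%N.
by exists [:: 1] => g; exists 1; rewrite ?inE.
Qed.

Lemma pro_p_openE (G : groupType) :
  @open (pro_p p G) = [set \bigcup_(B in D) B |
    D in [set D | D `<=` finI_from (pro_p_cosets p G) id]].
Proof. by []. Qed.

(** The cosets [x V] form a neighbourhood base at [x]: a coset of [U] containing [x] is [x U], and
    finite intersections reduce to one [V] by [finite_pgroupI]. *)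
Lemma pro_p_openP (G : groupType) (A : set (pro_p p G)) :
  open A <-> forall x : G, A x -> exists V : normalClosed G,
    finite_pgroup p (quotgrp V) /\ forall y : G, x^-1 * y \in V -> A y.
Proof.
rewrite pro_p_openE; split=> [[D Dfin <-] x [B DB Bx]|H].
  have [F sF BE] := Dfin _ DB.
  suff [V [pV VB]] : exists V : normalClosed G, finite_pgroup p (quotgrp V) /\
      forall y : G, x^-1 * y \in V -> forall C, C \in (F : seq _) -> C y.
    by exists V; split=> // y Vy; exists B => //; rewrite -BE => C CF; exact: VB Vy C CF.
  have : forall C, C \in (F : seq _) -> pro_p_cosets p G C /\ C x.
    by move=> C CF; split; [apply/set_mem/sF | move: Bx; rewrite -BE; exact].
  elim: (F : seq _) => [|C s IHs] Hs.
    by have [U [pU _]] := finite_pgroupT G; exists U.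
  have [|V [pV VB]] := IHs; first by move=> C' C's; apply: Hs; rewrite inE C's orbT.
  have [|[U [g [pU CE]]] Cx] := Hs C; first by rewrite inE eqxx.
  have [W [pW inW]] := finite_pgroupI pU pV.
  exists W; split=> // y; rewrite inW => /andP[Uy Vy] C'; rewrite inE => /orP[/eqP->|].
    move: Cx; rewrite CE => -[u Uu ux]; exists (u * (x^-1 * y)); first exact: gpredM.
    by rewrite mulgA ux mulVKg.
  exact: VB.
exists [set B | pro_p_cosets p G B /\ B `<=` A].
  by move=> B [cB _]; exact: (finI_from1 id).
apply/seteqP; split=> [x [B [_ BA] Bx]|x Ax]; first exact: BA.
have [V [pV VA]] := H x Ax.
exists [set x * u | u in [set` V]].
  by split; [exists V, x | move=> _ [u Vu <-]; apply: VA; rewrite mulKg].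
by exists 1; [exact: gpred1 | exact: mulg1].
Qed.

End ProPNeighbourhoods.

(** * Extending finite [p]-quotients from [H] to [G] *)

Section ProductSet.
Variables (G : groupType) (A N : set G).
Hypothesis sA : subgroup_set A.
Hypothesis nN : normal_set N.

Definition product_set : set G := [set a * n | a in A & n in N].

Lemma product_sgrp : subgroup_set product_set.
Proof.
have [sN JN] := nN; split=> [|_ _ [a Aa [m Nm <-]] [b Ab [n Nn <-]]].
  by exists 1; [exact: (sgrp1 sA) | exists 1; [exact: (sgrp1 sN) | rewrite mulg1]].
exists (a * b^-1); first exact: sA.2.
exists ((m * n^-1) ^ b^-1); first by apply: JN; exact: sN.2.
by rewrite /conjg invgK invgM !mulgA mulgVK.
Qed.

End ProductSet.

(* Replacing [H] and [U] by [H N] and [U N], where [N] meets [H] trivially and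
   [G / N] is nilpotent, puts a term of the lower central series below [U]. *)
Lemma pro_p_extension (G : groupType) (H : groupClosed G) (N : set G) (p : nat)
    (U : normalClosed (subgrp H)) :
  finitely_generated G -> torsion_free_nilpotent_kernel N ->
  (forall h : subgrp H, N (\val h) -> h = 1) -> prime p ->
  finite_pgroup p (quotgrp U) ->
  exists V : normalClosed G,
    finite_pgroup p (quotgrp V) /\ forall h : subgrp H, \val h \in V -> h \in U.
Proof.
move=> fgG [nN _ [c LN]] NH p_pr /(quotgrp_finite_pgroupP _ p_pr)[_ [e powU]].
have [sN JN] := nN.
pose A : set G := [set` H]; pose B : set G := [set \val u | u in [set` U]].
have sA : subgroup_set A by exact: subgroup_set_pred.
have sB : subgroup_set B.
  split=> [|_ _ [u Uu <-] [v Uv <-]]; first by exists 1; rewrite ?gmulf1 //=; exact: gpred1.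
  by exists (u * v^-1); rewrite ?gmulfF //=; exact: gpredF.
have BA : B `<=` A by move=> _ [u _ <-]; exact: subgrp_valP.
have sAN := product_sgrp sA nN; have sBN := product_sgrp sB nN.
have BBN : B `<=` product_set B N.
  by move=> b Bb; exists b => //; exists 1; [exact: (sgrp1 sN) | rewrite mulg1].
have NBN : N `<=` product_set B N.
  by move=> n Nn; exists 1; [exact: (sgrp1 sB) | exists n => //; rewrite mul1g].
have NconjBN n g : N n -> product_set B N g -> product_set B N (g ^ n).
  by move=> Nn BNg; apply: (sgrpJ sBN) => //; exact: NBN.
have [||||V [f [nV powV LV VAB]]] :=
    @subgroup_pow_extension G fgG p _ _ c e p_pr sAN sBN.
- by move=> _ [b Bb [n Nn <-]]; exists b; [exact: BA | exists n].
- move=> _ _ [_ [u Uu <-] [n Nn <-]] [h Hh [m Nm <-]].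
  rewrite conjgM; apply: NconjBN => //; rewrite conjMg; apply: (sgrpM sBN).
    apply: BBN; exists (u ^ Subgrp Hh); last by rewrite gmulfJ.
    exact: Defs.gpredJ.
  by apply: NBN; exact: JN.
- move=> _ [h Hh [n Nn <-]].
  have Nh : normalizes N h by move=> x Nx; split; exact: JN.
  (* Modulo [N], the power of [h * n] is that of [h], which lies in [U]. *)
  have := normalized_expM (p ^ e) sN Nh Nn => /NBN; apply: (sgrpMl sBN).
  apply: (sgrpV sBN); apply: BBN; exists (Subgrp Hh ^+ (p ^ e)); first exact: powU.
  by rewrite gmulfXn.
- by move=> x /LN; exact: NBN.
have inV x : (x \in normalClosed_of nV) = `[< V x >] by exact: in_normalClosed_of.
exists (normalClosed_of nV); split.
  apply/quotgrp_finite_pgroupP => //; split; last first.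
    by exists f => g; rewrite inV; apply/asboolP.
  have [|L HL] := @subgroup_pow_finite_index G fgG (p ^ f)%N c V _ nV.1 powV LV.
    by rewrite expn_gt0 prime_gt0.
  exists L => g; have [l lL Vgl] := HL g; exists l => //; rewrite inV; apply/asboolP.
  have -> : l^-1 * g = (g * l^-1) ^ g by rewrite /conjg !mulgA mulVg mul1g.
  exact: nV.2.
move=> h; rewrite inV => /asboolP Vh.
(* [V] meets [H N] inside [U N], so [h] is [u * n]; then [n] lies in both [H] and [N] and is
   trivial. *)
have [|_ [u Uu <-] [n Nn unh]] := VAB (\val h).
  split=> //; exists (\val h); first exact: subgrp_valP.
  by exists 1; [exact: (sgrp1 sN) | rewrite mulg1].
suff : u^-1 * h = 1 by move=> /mulg1_eq; rewrite invgK => <-.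
by apply: NH; rewrite gmulfM gmulfV; move: Nn; rewrite (canRL (mulKg _) unh).
Qed.

Theorem theoremB (G : groupType) (H : groupClosed G) :
  finitely_generated G ->
  residually_torsion_free_nilpotent G ->
  virtually_polycyclic (subgrp H) ->
  nilpotent_group (subgrp H) /\
  (forall p : nat, prime p -> induces_full_pro_p p H).
Proof.
move=> fgG rG [K [finK polyK]].
pose f : UMagmaMorphism.type (subgrp K) G := (\val : subgrp H -> G) \o \val.
have [N [kN Nf]] := kernel_avoiding_polycyclic f polyK rG.
have [[sN _] _ [c LN]] := kN.
(* A positive power of [h] lies in [K] and in [N], hence is trivial, and [G] is torsion-free. *)
have NH (h : subgrp H) : N (\val h) -> h = 1.
  move=> Nh; have [n n_gt0 Kh] := finite_index_pow h finK.
  apply: val_inj; transitivity (1 : G); last by rewrite val1.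
  apply: (residually_tfn_torsion_free rG n_gt0); rewrite -gmulfXn.
  by apply: (Nf (Subgrp Kh)); have := sgrpX sN n Nh; rewrite -gmulfXn.
split.
  exists c; apply/seteqP; split=> [h Lh|_ ->]; last exact: (sgrp1 (lower_central_normal _ _).1).
  by apply: NH; apply: LN; exact: (lower_central_morph (\val : subgrp H -> G)).
move=> p p_pr; apply/seteqP; split=> A.
  (* The inclusion of [H] is continuous, as finite [p]-quotients restrict to [H]. *)
  move=> [B /(pro_p_openP p_pr) openB <-]; apply/(pro_p_openP p_pr) => x Bx.
  have [V [pV VB]] := openB _ Bx.
  have [U [pU inU]] := finite_pgroup_preim p_pr (\val : subgrp H -> G) pV.
  by exists U; split=> // y; rewrite inU gmulfM gmulfV; exact: VB.
move=> /(pro_p_openP p_pr) openA.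
(* The witness is the union of the cosets [x V], for [x] in [A], whose trace on [H] lies in [A]. *)
exists [set g : G | exists x : subgrp H, exists V : normalClosed G,
   [/\ A x, finite_pgroup p (quotgrp V), (\val x)^-1 * g \in V &
      forall y : subgrp H, (\val x)^-1 * \val y \in V -> A y]].
  apply/(pro_p_openP p_pr) => g [x [V [Ax pV Vg VA]]]; exists V; split=> // y Vy.
  exists x, V; split=> //; have := gpredM _ _ Vg Vy.
  by rewrite mulgA mulgK.
apply/seteqP; split=> [y [x [V [_ _ Vy VA]]]|x Ax]; first exact: VA.
have [U [pU UA]] := openA x Ax.
have [V [pV VU]] := pro_p_extension fgG kN NH p_pr pU.
exists x, V; split=> //; first by rewrite mulVg gpred1.
by move=> y Vy; apply: UA; apply: VU; rewrite gmulfM gmulfV.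
Qed.
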